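(* Let $S$ and $T$ be countable discrete inverse semigroups with symmetric generating sets $K_S\subset S$ and $K_T\subset T$, such that the extended metric spaces $\Lambda(S,K_S)$ and $\Lambda(T,K_T)$ are quasi-isometric. Suppose that both pairs $(S,K_S)$ and $(T,K_T)$ admit a finite labeling. If $T$ is domain measurable, then so is $S$.
   Context: An inverse semigroup is a non-empty set $S$ with an associative product such that for each $s\in S$ there is a unique $s^*\in S$ with $ss^*s=s$ and $s^*ss^*=s^*$. For $s\in S$ put $D_{s^*s}=\{x\in S: s^*sx=x\}$. Write $x\,\mathcal{L}\,y$ iff $x^*x=y^*y$. A (countable) generating set $K\subset S$ is symmetric if $k\in K$ implies $k^*\in K$. Graph: $\Lambda(S,K)$ has vertex set $S$, and $x,y\in S$ are joined by an edge labeled by $k\in K$ iff $x\,\mathcal{L}\,y$ and $kx=y$. It is undirected and carries the path metric, with distance $\infty$ between distinct connected components. Finite labeling: $(S,K)$ admits a finite labeling if there are $C\ge 1$ and a finite $K_1\subset K$ such that for all $x,y\in S$ with $x\,\mathcal{L}\,y$ and $y\in Kx$ one has $y\in K_1^p x$ for some $p\in\{1,\dots,C\}$, where $K_1^p$ is the set of words of length $p$ in $K_1$. Quasi-isometry: extended metric spaces $(X,d_X)$, $(Y,d_Y)$ (metrics with values in $[0,\infty]$) are quasi-isometric if there is $\phi:X\to Y$, constants $M>0$, $C\ge0$ with $\frac1M d_X(x,x')-C\le d_Y(\phi(x),\phi(x'))\le M d_X(x,x')+C$ for all $x,x'\in X$, and $R>0$ such that every $y\in Y$ satisfies $d_Y(y,\phi(x))\le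 R$ for some $x\in X$. Domain measurability: $S$ is domain measurable if there is a finitely additive probability measure $\mu:\mathcal{P}(S)\to[0,1]$ on all subsets of $S$ with $\mu(sA)=\mu(A)$ for all $s\in S$ and $A\subset D_{s^*s}$. *)

(* Defs.v *)
From HB Require Import structures.
From mathcomp Require Import all_boot all_order all_algebra.
From mathcomp Require Import boolp classical_sets cardinality.
From mathcomp Require Import reals constructive_ereal ereal.

Set Implicit Arguments.
Unset Strict Implicit.
Unset Printing Implicit Defensive.

Import Order.TTheory GRing.Theory Num.Theory.

Local Open Scope classical_set_scope.
Local Open Scope ring_scope.

HB.mixin Record Semigroup_isInverseSemigroup S of Semigroup S := {
  inhabited_subproof : inhabited S;
  star : S -> S;
  mul_star_mul : forall s : S, (s * star s * s = s)%g;
  star_mul_star : forall s : S, (star s * s * star s = star s)%g;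
  star_unique : forall s t : S,
    (s * t * s = s)%g -> (t * s * t = t)%g -> t = star s
}.

#[short(type="inverseSemigroupType")]
HB.structure Definition InverseSemigroup :=
  {S of Semigroup_isInverseSemigroup S & Semigroup S}.

Section InverseSemigroupDefs.
Variable S : inverseSemigroupType.
Implicit Types (s k x y : S) (A B K : set S).

(* The set D_{s^* s} on which left multiplication by s is injective. *)
Definition left_domain s : set S := [set x | (star s * s * x)%g = x].

Definition Lrel x y : Prop := (star x * x)%g = (star y * y)%g.

Definition subsemigroup A : Prop := forall x y, A x -> A y -> A (x * y)%g.

(* Generation as a semigroup; for a symmetric K this is the same as generation
   as an inverse semigroup. *)
Definition generating K : Prop := smallest subsemigroup K = setT.

Definition symmetric_set K : Prop := forall k, K k -> K (star k).

Definition mulset A B : set S := [set (a * b)%g | a in A & b in B].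

(* K^p for p >= 1. There is no empty word in a semigroup, so the value set0 at
   p = 0 is a dummy. *)
Definition words K (p : nat) : set S := iterop p mulset K set0.

Definition adjacent K x y : Prop :=
  Lrel x y /\ exists2 k, K k & (k * x)%g = y.

(* When K is symmetric, so is adjacent K, and this is the path metric of an
   undirected graph. The infimum of the empty set is +oo, which gives distance
   +oo between distinct connected components. *)
Definition graph_dist (R : realType) K x y : \bar R :=
  ereal_inf [set (size p)%:R%:E | p in
    [set p : seq S | path (fun a b => `[< adjacent K a b >]) x p
                     /\ last x p = y]].

Definition finite_labeling K : Prop :=
  exists (C : nat) (K1 : set S),
    [/\ (1 <= C)%N, finite_set K1, K1 `<=` K &
        forall x y, Lrel x y -> (exists2 k, K k & y = (k * x)%g) ->
          exists2 p : nat, (1 <= p <= C)%N &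
            exists2 w, words K1 p w & y = (w * x)%g].

Definition finitely_additive_probability (R : realType) (mu : set S -> R)
    : Prop :=
  [/\ forall A, 0 <= mu A <= 1,
      mu setT = 1 &
      forall A B, A `&` B = set0 -> mu (A `|` B) = mu A + mu B].

Definition domain_measurable (R : realType) : Prop :=
  exists2 mu : set S -> R, finitely_additive_probability mu &
    forall s A, A `<=` left_domain s -> mu [set (s * a)%g | a in A] = mu A.

End InverseSemigroupDefs.

Definition quasi_isometric (R : realType) (X Y : Type)
    (dX : X -> X -> \bar R) (dY : Y -> Y -> \bar R) : Prop :=
  exists (phi : X -> Y) (M C : R),
    [/\ 0 < M, 0 <= C,
        forall x x', ((M^-1)%:E * dX x x' - C%:E <= dY (phi x) (phi x')
                      <= M%:E * dX x x' + C%:E)%E &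
        exists2 r : R, 0 < r & forall y, exists x, (dY y (phi x) <= r%:E)%E].

(* Main.v *)
Require Import Defs.
From mathcomp Require Import all_boot all_order all_algebra.
From mathcomp Require Import boolp classical_sets cardinality.
From mathcomp Require Import reals constructive_ereal ereal.

(** The measure on [T] is pulled back along the quasi-isometry
    [phi : S -> T], counting multiplicities.

    Finite labeling turns metric statements into algebraic ones.  Between two
    points at distance at most [r] there is a path of bounded length, each of
    whose edges is left multiplication by a word of bounded length in a finite
    set; so finitely many translations (left multiplications and the identity)
    suffice to carry any point to any point at distance at most [r]
    ([finitely_translated_dist]).  Two
    consequences are used.

    - In [S]: two points in one fiber of [phi] are at distance at most [M * C],
      so each fiber is covered by the images of one of its points under
      finitely many maps.  Hence [S] splits into finitely many pieces [S_i] on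
      each of which [phi] is injective ([fiber_coloring]).
    - In [T]: a domain invariant measure [mu] is preserved by every injective
      map of bounded displacement, because such a map is, on each of finitely
      many pieces of its domain, a translation
      ([measure_finitely_translated]).

    Put [nu A = \sum_i mu (phi @` (A `&` S_i))].  As [phi] is injective on each
    [S_i], this is finitely additive.  If [k] is a generator and [A] lies in
    the domain of [k], cut [A] according to the pieces containing [x] and
    [k * x]; on each part both [phi x] and [phi (k * x)] depend injectively on
    [x], and they stay at bounded distance, so [mu] does not distinguish the
    two images, and [nu (k A) = nu A] ([pullback_translate]).  Invariance under
    the generators gives invariance under all of [S]
    ([generators_invariant]).  Finally [nu] has positive total mass, since
    finitely many translations carry all of [T] into [phi(S)]
    ([pullback_gt0]), and can be normalized. *)

Set Implicit Arguments.
Unset Strict Implicit.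
Unset Printing Implicit Defensive.

Import Order.TTheory GRing.Theory Num.Theory.

Local Open Scope classical_set_scope.
Local Open Scope ring_scope.

(** * Idempotents, stars and domains in an inverse semigroup *)

Section InverseSemigroupTheory.
Variable S : inverseSemigroupType.
Implicit Types (a b e f s t x y z : S).
Local Open Scope group_scope.

Lemma starK s : star (star s) = s.
Proof.
by apply/esym/star_unique; [exact: star_mul_star | exact: mul_star_mul].
Qed.

(** If [x] is the inverse of [e * f], then [f * x * e] is another one, so
    [x = f * x * e], which is idempotent; hence so is its inverse [e * f]. *)
Lemma mul_idem e f : e * e = e -> f * f = f -> (e * f) * (e * f) = e * f.
Proof.
move=> ee ff; set x := star (e * f).
have x1 : e * f * x * e * f = e * f.
  by have := mul_star_mul (e * f); rewrite !mulgA.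
have x2 : x * e * f * x = x.
  by have := star_mul_star (e * f); rewrite !mulgA.
have fxe : f * x * e = x.
  apply: star_unique; rewrite !mulgA.
    by rewrite -(mulgA e f f) ff -(mulgA (e * f * x) e e) ee x1.
  rewrite -(mulgA (f * x) e e) ee -(mulgA (f * x * e) f f) ff.
  by rewrite -[in RHS]x2 !mulgA.
have xx : x * x = x.
  rewrite -[in LHS]fxe; have : f * (x * e * f * x) * e = x by rewrite x2.
  by rewrite !mulgA.
have : star x = x by apply/esym/star_unique; rewrite !xx.
by rewrite {1}/x starK => ->.
Qed.

(** By [mul_idem], [e * f] and [f * e] are idempotent, and then each is both
    its own inverse and the inverse of the other. *)
Lemma idem_comm e f : e * e = e -> f * f = f -> e * f = f * e.
Proof.
move=> ee ff.
have idem_star (g : S) : g * g = g -> star g = g.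
  by move=> gg; apply/esym/star_unique; rewrite !gg.
have ef := mul_idem ee ff; have fe := mul_idem ff ee.
rewrite -(idem_star (f * e)) //; apply: star_unique; rewrite !mulgA in ef fe *.
  by rewrite -(mulgA f e e) ee -(mulgA (f * e) f f) ff.
by rewrite -(mulgA e f f) ff -(mulgA (e * f) e e) ee.
Qed.

Lemma idem_star_mul s : (star s * s) * (star s * s) = star s * s.
Proof. by rewrite mulgA star_mul_star. Qed.

Lemma idem_mul_star s : (s * star s) * (s * star s) = s * star s.
Proof. by rewrite mulgA mul_star_mul. Qed.

Lemma starM a b : star (a * b) = star b * star a.
Proof.
have C := idem_comm (idem_mul_star b) (idem_star_mul a).
apply/esym/star_unique.
  have -> : a * b * (star b * star a) * (a * b)
            = a * (b * star b * (star a * a)) * b by rewrite !mulgA.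
  by rewrite C !mulgA mul_star_mul -!mulgA (mulgA b) mul_star_mul.
have -> : star b * star a * (a * b) * (star b * star a)
          = star b * (star a * a * (b * star b)) * star a by rewrite !mulgA.
by rewrite -C !mulgA star_mul_star -!mulgA (mulgA (star a)) star_mul_star.
Qed.

(** An edge of the graph from [x] to [t * x] is exactly an instance where
    multiplication by [t] acts on its domain: this is the link between the
    metric and domain measurability. *)
Lemma LrelP t x : Lrel x (t * x) <-> left_domain t x.
Proof.
rewrite /Lrel /left_domain /= starM; split=> [L|D]; last first.
  by rewrite mulgA -(mulgA _ (star t) t) -(mulgA (star x)) D.
have C := idem_comm (idem_mul_star x) (idem_star_mul t).
have : x * (star x * x) = x * star x * (star t * t) * x.
  by rewrite L !mulgA.
by rewrite mulgA mul_star_mul C -!mulgA (mulgA x) mul_star_mul => {2}->.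
Qed.

(** From [x = star b * star a * a * b * x] it follows that [star b * b] fixes
    [x], and, the idempotents [b * star b] and [star a * a] commuting, that
    [star a * a] fixes [b * x]. *)
Lemma left_domainM a b x :
  left_domain (a * b) x -> left_domain b x /\ left_domain a (b * x).
Proof.
rewrite /left_domain /= starM => D.
have Db : star b * b * x = x.
  by rewrite -[in LHS]D !mulgA star_mul_star -[in RHS]D !mulgA.
split=> //.
have C := idem_comm (idem_mul_star b) (idem_star_mul a).
have -> : star a * a * (b * x) = star a * a * (b * star b) * (b * x).
  by rewrite -{1}Db !mulgA.
rewrite -C.
have -> : b * star b * (star a * a) * (b * x)
          = b * (star b * star a * (a * b) * x) by rewrite !mulgA.
by rewrite D.
Qed.

Lemma left_domain_inj t x y :
  left_domain t x -> left_domain t y -> t * x = t * y -> x = y.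
Proof. by move=> Dx Dy E; rewrite -Dx -Dy -!mulgA E. Qed.

Lemma Lrel_trans x y z : Lrel x y -> Lrel y z -> Lrel x z.
Proof. by rewrite /Lrel => ->. Qed.

(** * Relations covered by finitely many translations *)

(** The identity, which need not be a left multiplication in a semigroup,
    accounts for paths of length 0. *)
Definition translation (g : S -> S) := g = id \/ exists t, g = (fun x => t * x).

Definition finitely_translated (E : S -> S -> Prop) :=
  exists (I : finType) (g : I -> S -> S),
    (forall i, translation (g i)) /\ forall x y, E x y -> exists i, y = g i x.

Lemma sub_finitely_translated (E E' : S -> S -> Prop) :
  (forall x y, E x y -> E' x y) ->
  finitely_translated E' -> finitely_translated E.
Proof.
by move=> EE' [I [g [tg gE]]]; exists I, g; split=> // x y /EE'; apply: gE.
Qed.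

Lemma finitely_translated_eq : finitely_translated eq.
Proof.
by exists unit, (fun=> id); split=> [_|x y ->]; [left | exists tt].
Qed.

Lemma finitely_translated_or (E E' : S -> S -> Prop) :
  finitely_translated E -> finitely_translated E' ->
  finitely_translated (fun x y => E x y \/ E' x y).
Proof.
move=> [I [g [tg gE]]] [I' [g' [tg' gE']]].
exists (I + I')%type, (fun u => match u with inl i => g i | inr i => g' i end).
split=> [[]//|x y [/gE|/gE'] [i ->]]; by [exists (inl i) | exists (inr i)].
Qed.

Lemma translation_comp g g' :
  translation g -> translation g' -> translation (g \o g').
Proof.
move=> [->//|[t ->]] [->|[t' ->]]; right; [by exists t|exists (t * t')].
by apply/funext => x /=; rewrite mulgA.
Qed.

Lemma finitely_translated_comp (E E' : S -> S -> Prop) :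
  finitely_translated E -> finitely_translated E' ->
  finitely_translated (fun x z => exists2 y, E x y & E' y z).
Proof.
move=> [I [g [tg gE]]] [I' [g' [tg' gE']]].
exists (I * I')%type, (fun u => g' u.2 \o g u.1).
split=> [u|x z [y /gE[i ->] /gE'[j ->]]]; first exact: translation_comp.
by exists (i, j).
Qed.

(** * Finite labeling and bounded distance *)

Lemma finitely_translated_finite (K : set S) : finite_set K ->
  finitely_translated (fun x y => exists2 k, K k & y = k * x).
Proof.
move=> /finite_seqP[s ->].
exists (seq_sub s), (fun k x => ssval k * x); split=> [k|x y [k ks ->]].
  by right; exists (ssval k).
by exists (SeqSub ks).
Qed.

Lemma finitely_translated_words (K : set S) p : finite_set K ->
  finitely_translated (fun x y => exists2 w, words K p w & y = w * x).
Proof.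
move=> finK; elim: p => [|[|p] IH]; first 2 last.
- apply: sub_finitely_translated
    (finitely_translated_comp IH (finitely_translated_finite finK)) => x y.
  case=> _ [a Ka [b Kb <-]] ->.
  by exists (b * x); [exists b | exists a; rewrite ?mulgA].
- by apply: sub_finitely_translated finitely_translated_eq => x y [].
- exact: finitely_translated_finite.
Qed.

Lemma finitely_translated_adjacent (K : set S) : finite_labeling K ->
  finitely_translated (adjacent K).
Proof.
move=> [C [K1 [_ finK1 _ lab]]].
have : finitely_translated (fun x y => exists2 p, (p <= C)%N &
          exists2 w, words K1 p w & y = w * x).
  (* The extra length 0 adds nothing, as [words K1 0] is empty. *)
  elim: (C) => [|n IH].
    apply: sub_finitely_translated (finitely_translated_words 0%N finK1) => x y.
    by case=> p; rewrite leqn0 => /eqP ->.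
  apply: sub_finitely_translated
    (finitely_translated_or IH (finitely_translated_words n.+1 finK1)) => x y.
  case=> p; rewrite leq_eqVlt => /predU1P[->|pn] H; [by right|].
  by left; exists p.
apply: sub_finitely_translated => x y [L [k Kk kxy]].
have [|p /andP[_ pC] H] := lab _ _ L; first by exists k.
by exists p.
Qed.

Lemma finitely_translated_path (K : set S) n : finite_labeling K ->
  finitely_translated (fun x y => exists2 p : seq S, (size p <= n)%N &
    path (fun a b => `[< adjacent K a b >]) x p /\ last x p = y).
Proof.
move=> lab; elim: n => [|n IH].
  apply: sub_finitely_translated finitely_translated_eq => x y.
  by case=> -[|//] _ [].
apply: sub_finitely_translated
  (finitely_translated_or finitely_translated_eq
    (finitely_translated_comp (finitely_translated_adjacent lab) IH)) => x y.
case=> -[_ [_]|a p /= pn [/andP[/asboolP xa ap] py]]; first by left.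
by right; exists a => //; exists p.
Qed.

Lemma path_Lrel (K : set S) x p :
  path (fun a b => `[< adjacent K a b >]) x p -> Lrel x (last x p).
Proof.
elim: p x => [//|a p IH] x /= /andP[/asboolP[xa _] /IH].
exact: Lrel_trans.
Qed.

End InverseSemigroupTheory.

Section GraphDistance.
Variables (R : realType) (S : inverseSemigroupType) (K : set S).
Implicit Types (x y : S) (r : R).

Lemma graph_dist_path x y r : (graph_dist R K x y <= r%:E)%E ->
  exists2 p : seq S, (size p <= Num.bound `|r|)%N &
    path (fun a b => `[< adjacent K a b >]) x p /\ last x p = y.
Proof.
move=> d.
have /ereal_inf_lt : (graph_dist R K x y < (Num.bound `|r|)%:R%:E)%E.
  by apply: le_lt_trans d _; rewrite lte_fin;
    exact: le_lt_trans (ler_norm r) (archi_boundP (normr_ge0 r)).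
move=> [_ [p pxy <-]]; rewrite lte_fin ltr_nat => /ltnW pb.
by exists p.
Qed.

Lemma graph_dist_le_path x p :
  path (fun a b => `[< adjacent K a b >]) x p ->
  (graph_dist R K x (last x p) <= (size p)%:R%:E)%E.
Proof. by move=> xp; apply: ge_ereal_inf; eexists; [exists p|]. Qed.

Lemma graph_dist_Lrel x y r : (graph_dist R K x y <= r%:E)%E -> Lrel x y.
Proof. by move=> /graph_dist_path[p _ [/path_Lrel ? <-]]. Qed.

(** This is how finite labeling enters the proof: a ball of radius [r] is
    covered by finitely many translations, the same for all centers. *)
Lemma finitely_translated_dist r : finite_labeling K ->
  finitely_translated (fun x y => graph_dist R K x y <= r%:E)%E.
Proof.
move=> lab; apply: sub_finitely_translated
  (finitely_translated_path (Num.bound `|r|) lab) => x y.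
exact: graph_dist_path.
Qed.

End GraphDistance.

(** * Splitting a space into pieces on which a map is injective *)

Definition injective_on (X Y : Type) (A : set X) (f : X -> Y) :=
  forall x y, A x -> A y -> f x = f y -> x = y.

(** Fix a representative in each fiber.  Every point is the image of the
    representative of its fiber under one of finitely many maps; the index of
    such a map, used as a color, determines the point within its fiber. *)
Lemma fiber_coloring (S : inverseSemigroupType) (E : S -> S -> Prop)
    (Y : Type) (phi : S -> Y) :
  finitely_translated E -> (forall x y, phi x = phi y -> E x y) ->
  exists (I : finType) (c : S -> I),
    forall i, injective_on [set x | c x = i] phi.
Proof.
move=> [I [g [_ gE]]] phiE; have [x0] := @inhabited_subproof S.
have /choice[rep repP] : forall y, exists x, forall x', phi x' = y -> phi x = y.
  move=> y; have [[x xy]|no] := pselect (exists x, phi x = y).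
    by exists x.
  by exists x0 => x xy; case: no; exists x.
have /choice[c cP] : forall x, exists i, x = g i (rep (phi x)).
  by move=> x; apply/gE/phiE/(repP _ x).
by exists I, c => i x y /= cx cy xy; rewrite (cP x) (cP y) cx cy xy.
Qed.

(** * Finitely additive measures and maps of bounded displacement *)

Section FinitelyAdditive.
Variables (R : realType) (T : inverseSemigroupType) (mu : set T -> R).
Hypothesis mu_prob : finitely_additive_probability mu.

Lemma fap_ge0 A : 0 <= mu A.
Proof. by case: mu_prob => /(_ A)/andP[]. Qed.

Lemma fap_set0 : mu set0 = 0.
Proof.
case: mu_prob => _ _ /(_ set0 set0); rewrite setI0 setU0 => /(_ erefl) E.
by apply: (addrI (mu set0)); rewrite -E addr0.
Qed.

Lemma le_fap A B : A `<=` B -> mu A <= mu B.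
Proof.
move=> AB; rewrite -(setDUK AB); case: mu_prob => _ _ ->; last exact: setDIK.
by rewrite lerDl fap_ge0.
Qed.

Lemma fap_image_partition (Z : Type) (f : Z -> T) (P : set Z) (I : finType)
    (c : Z -> I) : injective_on P f ->
  mu (f @` P) = \sum_i mu (f @` (P `&` [set z | c z = i])).
Proof.
move=> injf.
suff H (r : seq I) : uniq r -> mu (f @` (P `&` [set z | c z \in r])) =
    \sum_(i <- r) mu (f @` (P `&` [set z | c z = i])).
  rewrite -H ?index_enum_uniq //; congr (mu (f @` _)).
  by apply/seteqP; split=> [z Pz|z []//]; split=> //=; rewrite mem_index_enum.
elim: r => [_|i r IH /= /andP[ir ur]].
  rewrite big_nil -[RHS]fap_set0; congr mu.
  by apply/seteqP; split=> // y [z []].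
rewrite big_cons -(IH ur); case: mu_prob => _ _ <-.
  congr mu; rewrite -image_setU -setIUr; congr (f @` (P `&` _)).
  apply/seteqP; split=> z /=; rewrite inE.
    by move=> /predU1P[->|]; [left | right].
  by move=> [->|->]; rewrite ?eqxx ?orbT.
apply/seteqP; split=> // _ [[z [Pz zi] <-] [z' [Pz' /= z'r] /injf]].
by move=> /(_ Pz' Pz) zz'; move: ir; rewrite -zi -zz' z'r.
Qed.

End FinitelyAdditive.

Section DomainInvariance.
Variables (R : realType) (T : inverseSemigroupType) (mu : set T -> R).
Hypothesis mu_prob : finitely_additive_probability mu.
Hypothesis mu_inv : forall s A, A `<=` left_domain s ->
  mu [set (s * a)%g | a in A] = mu A.

Lemma measure_translation g (A : set T) : translation g ->
  (forall a, A a -> Lrel a (g a)) -> mu (g @` A) = mu A.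
Proof.
move=> [->|[t ->]] L; first by rewrite image_id.
by apply: mu_inv => a /L /LrelP.
Qed.

(** The injection [a z |-> b z] from [a @` P] onto [b @` P] is given by one
    translation [g i] on each of the finitely many parts of [P].  Indexing by
    [Z], rather than by a subset of [T], lets [a] and [b] be two maps out of
    another semigroup. *)
Lemma measure_finitely_translated (E : T -> T -> Prop) (Z : Type)
    (P : set Z) (a b : Z -> T) : finitely_translated E ->
  injective_on P a -> injective_on P b ->
  (forall z, P z -> Lrel (a z) (b z) /\ E (a z) (b z)) ->
  mu (a @` P) = mu (b @` P).
Proof.
move=> [I [g [tg gE]]] inja injb ab.
have [[z0 Pz0]|noP] := pselect (exists z, P z); last first.
  have -> : P = set0 by apply/seteqP; split=> // z Pz; case: noP; exists z.
  by rewrite !image_set0.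
have /choice[c cP] : forall z, exists i, P z -> b z = g i (a z).
  move=> z; have [Pz|nPz] := pselect (P z).
    by have [_ /gE[i bz]] := ab _ Pz; exists i.
  by have [_ /gE[i _]] := ab _ Pz0; exists i.
rewrite (fap_image_partition mu_prob c inja).
rewrite (fap_image_partition mu_prob c injb).
apply: eq_bigr => i _.
rewrite -(measure_translation (g := g i)) //.
  congr mu; rewrite image_comp; apply: eq_imagel => z [Pz /= <-].
  by rewrite -cP.
by move=> _ [z [Pz /= <-] <-]; rewrite -cP //; case: (ab _ Pz).
Qed.

End DomainInvariance.

(** The elements under which [nu] is invariant form a subsemigroup: a set in
    the domain of [a * b] is moved by [b] into the domain of [a]. *)
Lemma generators_invariant (R : realType) (S : inverseSemigroupType)
    (K : set S) (nu : set S -> R) : generating K ->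
  (forall k A, K k -> A `<=` left_domain k ->
    nu [set (k * a)%g | a in A] = nu A) ->
  forall s A, A `<=` left_domain s -> nu [set (s * a)%g | a in A] = nu A.
Proof.
move=> genK invK s.
pose invariant := [set s : S | forall A, A `<=` left_domain s ->
  nu [set (s * a)%g | a in A] = nu A].
have : setT s by [].
rewrite -genK; apply: (@smallest_sub _ _ K invariant) => [|k Kk A].
  move=> a b inva invb A Aab.
  have -> : [set (a * b * x)%g | x in A]
            = [set (a * y)%g | y in [set (b * x)%g | x in A]].
    by rewrite image_comp; apply: eq_imagel => x _ /=; rewrite mulgA.
  rewrite inva ?invb // => [x /Aab/left_domainM[]//|].
  by move=> _ [x /Aab/left_domainM[_ ?] <-].
exact: invK.
Qed.

(** * Pulling back a measure along a finite-to-one map *)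

Section Pullback.
Variables (R : realType) (S T : inverseSemigroupType) (mu : set T -> R).
Hypothesis mu_prob : finitely_additive_probability mu.
Hypothesis mu_inv : forall s A, A `<=` left_domain s ->
  mu [set (s * a)%g | a in A] = mu A.
Variables (phi : S -> T) (I : finType) (c : S -> I).
Hypothesis phi_inj : forall i, injective_on [set x | c x = i] phi.

(** The integral over [T] of the number of points of [A] in the fiber of
    [phi], written as a finite sum over the color classes. *)
Definition pullback (A : set S) : R :=
  \sum_i mu (phi @` (A `&` [set x | c x = i])).

Lemma pullback_ge0 A : 0 <= pullback A.
Proof. by apply: sumr_ge0 => i _; exact: fap_ge0. Qed.

Lemma pullbackU A B : A `&` B = set0 ->
  pullback (A `|` B) = pullback A + pullback B.
Proof.
move=> AB0; rewrite -big_split; apply: eq_bigr => i _ /=.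
case: mu_prob => _ _ <-; first by rewrite setIUl image_setU.
apply/seteqP; split=> // _ [[x [Ax xi] <-] [y [By yi] /phi_inj]].
move=> /(_ _ yi xi) yx; suff : (A `&` B) x by rewrite AB0.
by split=> //; rewrite -yx.
Qed.

Lemma le_pullback A B : A `<=` B -> pullback A <= pullback B.
Proof.
move=> AB; apply: ler_sum => i _; apply: le_fap => //.
by apply: image_subset; apply: setSI.
Qed.

(** Both sides split over the pairs formed by the color [i] of [x] and the
    color [j] of [k * x].  Fixing [i] makes [phi] injective, fixing [j] makes
    [x |-> phi (k * x)] injective, so the two sums agree term by term. *)
Lemma pullback_translate (E : T -> T -> Prop) (k : S) A :
  finitely_translated E -> A `<=` left_domain k ->
  (forall x, A x ->
    Lrel (phi x) (phi (k * x)%g) /\ E (phi x) (phi (k * x)%g)) ->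
  pullback [set (k * a)%g | a in A] = pullback A.
Proof.
move=> finE Ak AE; rewrite /pullback.
pose P i j := A `&` [set x | c x = i] `&` [set x | c (k * x)%g = j].
have inj1 i j : injective_on (P i j) phi.
  by move=> x y [[_ xi] _] [[_ yi] _]; apply: phi_inj xi yi.
have injk j : injective_on (A `&` [set x | c (k * x)%g = j])
    (fun x => phi (k * x)%g).
  move=> x y [Ax xj] [Ay yj] /(phi_inj xj yj).
  by apply: left_domain_inj; apply: Ak.
have -> : \sum_j mu (phi @` ([set (k * a)%g | a in A] `&` [set x | c x = j]))
        = \sum_j \sum_i mu ((fun x => phi (k * x)%g) @` P i j).
  apply: eq_bigr => j _.
  have -> : phi @` ([set (k * a)%g | a in A] `&` [set x | c x = j]) =
    (fun x => phi (k * x)%g) @` (A `&` [set x | c (k * x)%g = j]).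
    apply/seteqP; split=> [_ [_ [[x Ax <-] xj] <-]|_ [x [Ax xj] <-]].
      by exists x.
    by exists (k * x)%g => //; split=> //; exists x.
  rewrite (fap_image_partition mu_prob c (injk j)).
  by apply: eq_bigr => i _; rewrite /P setIAC.
rewrite exchange_big; apply: eq_bigr => i _ /=.
rewrite (@fap_image_partition _ _ _ mu_prob _ _ _ _ (fun x => c (k * x)%g)).
  apply: eq_bigr => j _; apply/esym.
  apply: (measure_finitely_translated mu_prob mu_inv finE (inj1 i j)).
    by move=> x y [[Ax _] xj] [[Ay _] yj]; exact: (injk j).
  by move=> x [[/AE]].
by move=> x y [_ xi] [_ yi]; apply: phi_inj xi yi.
Qed.

(** If the total mass vanished, the image of every color class would be null.
    Each [y] is carried by some [g j] to some [phi x]; sorting the [y] by [j]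
    and by the color of [x] splits [T] into finitely many parts, each
    translated into such an image, so [mu setT] would be [0]. *)
Lemma pullback_gt0 (E : T -> T -> Prop) : finitely_translated E ->
  (forall y, exists x, Lrel y (phi x) /\ E y (phi x)) -> 0 < pullback setT.
Proof.
move=> [J [g [tg gE]]] dense.
have /choice[h hP] : forall y, exists u : S * J,
    Lrel y (phi u.1) /\ phi u.1 = g u.2 y.
  by move=> y; have [x [yx /gE[j xj]]] := dense y; exists (x, j).
rewrite lt_def pullback_ge0 andbT; apply/eqP => pb0.
have mu0 i : mu (phi @` [set x | c x = i]) = 0.
  have /(_ i isT) := psumr_eq0P (fun i _ => fap_ge0 mu_prob _) pb0.
  by rewrite setTI.
have : mu (id @` setT) = 0.
  rewrite (@fap_image_partition _ _ _ mu_prob _ _ _ _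
    (fun y => (c (h y).1, (h y).2))) //.
  apply: big1 => -[i j] _; rewrite image_id setTI.
  rewrite -(measure_translation mu_inv (tg j)); last first.
    by move=> y /= [_ <-]; case: (hP y) => L <-.
  apply/eqP; rewrite eq_le fap_ge0 // andbT -(mu0 i); apply: le_fap => //.
  move=> _ [y /= [yi <-] <-]; exists (h y).1 => //.
  by case: (hP y).
rewrite image_id; case: mu_prob => _ -> _ /eqP; by rewrite oner_eq0.
Qed.

End Pullback.

(** * The metric input from the quasi-isometry *)

Section QuasiIsometry.
Variables (R : realType) (S T : inverseSemigroupType).
Variables (KS : set S) (KT : set T) (phi : S -> T) (M C : R).
Hypothesis M0 : 0 < M.
Hypothesis qi : forall x x',
  ((M^-1)%:E * graph_dist R KS x x' - C%:E
     <= graph_dist R KT (phi x) (phi x')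
     <= M%:E * graph_dist R KS x x' + C%:E)%E.

(** In particular two points of one fiber lie in one connected component: the
    lower bound would otherwise be [+oo]. *)
Lemma qi_fiber_dist x x' : phi x = phi x' ->
  (graph_dist R KS x x' <= (M * C)%:E)%E.
Proof.
move=> xx'; have : (graph_dist R KT (phi x) (phi x') <= 0%:E)%E.
  by rewrite xx'; apply: (@graph_dist_le_path _ _ _ _ [::]).
case/andP: (qi x x') => + _ => /le_trans/[apply].
case: (graph_dist R KS x x') => [d||] //=; last by rewrite leNye.
  by rewrite -EFinM -EFinB !lee_fin subr_le0 ler_pdivrMl.
by rewrite gt0_muley ?lte_fin ?invr_gt0.
Qed.

Lemma qi_adjacent_dist k x : KS k -> left_domain k x ->
  (graph_dist R KT (phi x) (phi (k * x)%g) <= (M + C)%:E)%E.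
Proof.
move=> Kk /LrelP xk; case/andP: (qi x (k * x)%g) => _ /le_trans; apply.
have d1 : (graph_dist R KS x (k * x)%g <= 1%:E)%E.
  apply: (@graph_dist_le_path _ _ _ _ [:: (k * x)%g]) => /=.
  by rewrite andbT; apply/asboolP; split=> //; exists k.
rewrite EFinD leeD2r // -[leRHS]mule1.
by apply: lee_wpmul2l => //; rewrite lee_fin ltW.
Qed.

End QuasiIsometry.

Theorem theorem2 (R : realType) (S T : inverseSemigroupType)
    (KS : set S) (KT : set T)
    (countable_S : countable [set: S]) (countable_T : countable [set: T])
    (generating_KS : generating KS) (symmetric_KS : symmetric_set KS)
    (generating_KT : generating KT) (symmetric_KT : symmetric_set KT)
    (qi : quasi_isometric (graph_dist R KS) (graph_dist R KT))
    (labeling_S : finite_labeling KS) (labeling_T : finite_labeling KT) :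
  domain_measurable T R -> domain_measurable S R.
Proof.
move=> [mu mu_prob mu_inv].
have [phi [M [C [M0 _ phi_qi [r _ dense]]]]] := qi.
have [I [c phi_inj]] := fiber_coloring
  (finitely_translated_dist (M * C) labeling_S)
  (fun x x' => @qi_fiber_dist _ _ _ _ _ _ _ _ M0 phi_qi x x').
have tot0 : 0 < pullback mu phi c setT.
  apply: (pullback_gt0 mu_prob mu_inv c
    (finitely_translated_dist r labeling_T)) => y.
  by have [x yx] := dense y; exists x; split=> //; exact: graph_dist_Lrel yx.
exists (fun A => pullback mu phi c A / pullback mu phi c setT).
  split=> [A||A B AB]; last by rewrite pullbackU // mulrDl.
    rewrite divr_ge0 ?pullback_ge0 //= ler_pdivrMr // mul1r.
    exact: le_pullback.
  by rewrite divff // gt_eqF.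
apply: (generators_invariant generating_KS) => k A Kk Ak.
congr (_ / _); apply: (pullback_translate mu_prob mu_inv phi_inj
  (finitely_translated_dist (M + C) labeling_T) Ak) => x /Ak kx.
have d := qi_adjacent_dist M0 phi_qi Kk kx.
by split=> //; exact: graph_dist_Lrel d.
Qed.
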